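(* For integers $n\ge 1$ and $k\ge 0$ let $m_n$ be the number of Motzkin trees with $n$ vertices and let $b_{k,n}$ be the total number of balanced vertices of rank $k$ in all Motzkin trees with $n$ vertices, i.e. the number of pairs $(T,v)$ with $T$ a Motzkin tree on $n$ vertices and $v$ a balanced vertex of rank $k$ of $T$. Let $b_k=\lim_{n\to\infty}\frac{b_{k,n}}{n\,m_n}$ be the asymptotic proportion of balanced vertices of rank $k$ among all vertices of all Motzkin trees. Then these limits exist and, for every $k\ge 1$, $$b_k=\tfrac13\,b_{k-1}+\tfrac13\,b_{k-1}^2 .$$
   Context: A Motzkin tree (0-1-2 tree, unary-binary tree) is a rooted plane tree, with at least one vertex, in which every vertex has 0, 1 or 2 children (a single child carries no left/right distinction; two children are ordered). A leaf is a vertex with no children. The rank of a vertex $v$ is the length (number of edges) of the shortest path from $v$ to a leaf travelling strictly from parent to child; leaves have rank 0. A vertex $v$ is balanced if all parent-to-child paths from $v$ to a leaf have the same length; so a balanced vertex of rank $k$ is a vertex for which all such paths have length exactly $k$. *)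

(* Defs.v *)
From HB Require Import structures.
From mathcomp Require Import all_boot all_order all_algebra finmap.
From mathcomp Require Import all_classical all_reals all_analysis.
Import Order.TTheory GRing.Theory Num.Theory.
Import numFieldNormedType.Exports.

Set Implicit Arguments.
Unset Strict Implicit.
Unset Printing Implicit Defensive.

Local Open Scope classical_set_scope.

Inductive motzkin : Type :=
| Leaf
| Unary of motzkin
| Binary of motzkin & motzkin.

Fixpoint encode (t : motzkin) : GenTree.tree unit :=
  match t with
  | Leaf => GenTree.Node 0 [::]
  | Unary u => GenTree.Node 1 [:: encode u]
  | Binary l r => GenTree.Node 2 [:: encode l; encode r]
  end.

Fixpoint decode (g : GenTree.tree unit) : option motzkin :=
  match g with
  | GenTree.Node 0 [::] => Some Leaf
  | GenTree.Node 1 [:: u] => omap Unary (decode u)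
  | GenTree.Node 2 [:: l; r] =>
      if (decode l, decode r) is (Some l', Some r')
      then Some (Binary l' r') else None
  | _ => None
  end.

Lemma encodeK : pcancel encode decode.
Proof. by elim=> //= [u -> | l -> r ->]. Qed.

HB.instance Definition _ := Countable.copy motzkin (pcan_type encodeK).

Definition children (t : motzkin) : seq motzkin :=
  match t with
  | Leaf => [::]
  | Unary u => [:: u]
  | Binary l r => [:: l; r]
  end.

Fixpoint nb_vertices (t : motzkin) : nat :=
  match t with
  | Leaf => 1
  | Unary u => (nb_vertices u).+1
  | Binary l r => (nb_vertices l + nb_vertices r).+1
  end.

(* A vertex of t is encoded by its address, the sequence of child indices read
   along the path from the root; subtree t v is the subtree of t rooted at the
   address v, and is None when v is not the address of a vertex of t. *)
Fixpoint subtree (t : motzkin) (v : seq nat) : option motzkin :=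
  if v is i :: w then
    if onth (children t) i is Some u then subtree u w else None
  else Some t.

Definition is_vertex (t : motzkin) (v : seq nat) : Prop := subtree t v <> None.

Definition is_leaf (t : motzkin) (v : seq nat) : Prop := subtree t v = Some Leaf.

(* The downward paths from the vertex v to a leaf, each given as the sequence of
   child indices it follows, so that its length (number of edges) is its size. *)
Definition leaf_paths (t : motzkin) (v : seq nat) : set (seq nat) :=
  [set p | is_leaf t (v ++ p)].

Definition has_rank (t : motzkin) (v : seq nat) (k : nat) : Prop :=
  (exists2 p, leaf_paths t v p & size p = k) /\
  (forall p, leaf_paths t v p -> k <= size p).

Definition balanced (t : motzkin) (v : seq nat) : Prop :=
  forall p q, leaf_paths t v p -> leaf_paths t v q -> size p = size q.

Definition motzkin_trees (n : nat) : set motzkin :=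
  [set t | nb_vertices t = n].

Definition balanced_vertices (k n : nat) : set (motzkin * seq nat) :=
  [set tv | [/\ motzkin_trees n tv.1, is_vertex tv.1 tv.2,
                balanced tv.1 tv.2 & has_rank tv.1 tv.2 k]].

Lemma finite_motzkin_trees (n : nat) : finite_set (motzkin_trees n).
Proof.
suff fin m : finite_set [set t | nb_vertices t <= m].
  by apply: sub_finite_set (fin n) => t /= ->.
elim: m => [|m IHm]; first by apply: (sub_finite_set _ (finite_set0 _)); case.
pose S := [set t | nb_vertices t <= m].
apply: (@sub_finite_set _ _
  ([set Leaf] `|` (Unary @` S) `|` [set Binary l r | l in S & r in S])).
  case=> [|u|l r] /=; rewrite ?ltnS => le_m.
  - by left; left.
  - by left; right; exists u.
  - right; exists l; first exact: leq_trans (leq_addr _ _) le_m.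
    by exists r => //; exact: leq_trans (leq_addl _ _) le_m.
rewrite !finite_setU; do !split=> //; first exact: finite_image.
exact: finite_image2.
Qed.

Lemma finite_vertices (t : motzkin) : finite_set (is_vertex t).
Proof.
elim: t => [|u IHu|l IHl r IHr].
- by apply: (sub_finite_set _ (finite_set1 [::])) => -[|[|i] v].
- apply: (@sub_finite_set _ _ ([set [::]] `|` cons 0 @` is_vertex u)).
    by move=> [|[|[|i]] v] // uv; [left | right; exists v].
  by rewrite finite_setU; split=> //; exact: finite_image.
apply: (@sub_finite_set _ _
  ([set [::]] `|` cons 0 @` is_vertex l `|` cons 1 @` is_vertex r)).
  move=> [|[|[|[|i]]] v] // tv; first by left; left.
    by left; right; exists v.
  by right; exists v.
by rewrite !finite_setU; do !split=> //; exact: finite_image.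
Qed.

Lemma finite_balanced_vertices (k n : nat) : finite_set (balanced_vertices k n).
Proof.
apply: (@sub_finite_set _ _
  (\bigcup_(t in motzkin_trees n) (pair t @` is_vertex t))).
  by move=> [t v] [/= tn tv _ _]; exists t => //; exists v.
apply: bigcup_finite; first exact: finite_motzkin_trees.
by move=> t _; exact/finite_image/finite_vertices.
Qed.

(* fset_set A is empty when A is infinite; the sets counted below are finite. *)
Definition motzkin_number (n : nat) : nat := #|` fset_set (motzkin_trees n)|.

Definition balanced_number (k n : nat) : nat :=
  #|` fset_set (balanced_vertices k n)|.

Local Open Scope ring_scope.

Definition balanced_ratio (R : realType) (k n : nat) : R :=
  (balanced_number k n)%:R / (n%:R * (motzkin_number n)%:R).

Definition balanced_proportion (R : realType) (k : nat) : R :=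
  lim (balanced_ratio R k n @[n --> \oo]).

(* Main.v *)
(* Marking a balanced vertex of rank k amounts to choosing a balanced tree of
   rank k and a context, so the generating functions satisfy B_k D = A_k, where
   D = 1 - X - 2 X M, M is the Motzkin series, A_0 = X and
   A_(k+1) = X (A_k + A_k^2). The polynomial A_k counts the balanced trees of
   rank k. Let L = B_0 = X / D count the marked leaves. Then X B_k = A_k L, so
   the count of balanced vertices is a fixed finite combination of shifts of L,
   and b_k = A_k(1/3) as soon as consecutive coefficients of L have ratio
   tending to 3. This follows from D^2 = 1 - 2 X - 3 X^2, which turns D L = X
   into a three-term recurrence for the coefficients of L. Finally
   D (X M') = M expresses n m_n by two coefficients of L. *)

Require Import Defs.
From mathcomp Require Import all_boot all_order all_algebra finmap.
From mathcomp Require Import all_classical all_reals all_analysis.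
From mathcomp Require Import ring zify.
Import Order.TTheory GRing.Theory Num.Theory.
Import numFieldNormedType.Exports.
Local Open Scope classical_set_scope.
Local Open Scope ring_scope.

(** * Balanced vertices as roots of perfect subtrees *)

Fixpoint perfect (k : nat) (t : motzkin) : bool :=
  match k, t with
  | 0%N, Leaf => true
  | k'.+1, Unary u => perfect k' u
  | k'.+1, Binary l r => perfect k' l && perfect k' r
  | _, _ => false
  end.

Lemma exists_leaf (t : motzkin) : exists p, is_leaf t p.
Proof.
elim: t => [|u [p up]|l [p lp] r _]; first by exists [::].
  by exists (0%N :: p).
by exists (0%N :: p).
Qed.

(** Induction on the tree; every tree has a leaf, so a universal claim on leaf depths is never
    vacuous and excludes rank 0 at an inner vertex. *)
Lemma perfectP (k : nat) (t : motzkin) :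
  perfect k t <-> forall p, is_leaf t p -> size p = k.
Proof.
elim: t k => [|u IHu|l IHl r IHr] [|k] //=; split=> //.
- by move=> _ [|[|i] p].
- by move=> /(_ [::] erefl).
- by have [p up] := exists_leaf u => /(_ (0%N :: p) up).
- by move=> /IHu uk [|[|[|i]] p] //= /uk ->.
- by move=> uk; apply/IHu => p up; have [] := uk (0%N :: p) up.
- by have [p lp] := exists_leaf l => /(_ (0%N :: p) lp).
- by move=> /andP[/IHl lk /IHr rk] [|[|[|[|i]]] p] //= => [/lk|/rk] ->.
- move=> k_lr; apply/andP; split; [apply/IHl|apply/IHr] => p tp.
    by have [] := k_lr (0%N :: p) tp.
  by have [] := k_lr (1%N :: p) tp.
Qed.

Lemma subtree_cat (t : motzkin) (v w : seq nat) :
  subtree t (v ++ w) = obind (fun s => subtree s w) (subtree t v).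
Proof. by elim: v t => [|i v IHv] t //=; case: onth. Qed.

Definition perfect_at (k : nat) (t : motzkin) (v : seq nat) : bool :=
  if subtree t v is Some s then perfect k s else false.

(** The leaf paths from [v] are the leaf addresses of the subtree at [v]. This turns the path
    conditions into a boolean that can be counted. *)
Lemma perfect_atP (k : nat) (t : motzkin) (v : seq nat) :
  perfect_at k t v <-> [/\ is_vertex t v, balanced t v & has_rank t v k].
Proof.
rewrite /perfect_at; case tv: (subtree t v) => [s|]; last first.
  by split=> // -[] /(_ tv).
have leafE p : leaf_paths t v p <-> is_leaf s p.
  by rewrite /leaf_paths /= /is_leaf subtree_cat tv.
have [p0 sp0] := exists_leaf s.
split=> [/perfectP sk|[_ bal [[p /leafE sp <-] _]]]; last first.
  by apply/perfectP => q sq; apply: bal; apply/leafE.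
split; first by rewrite /is_vertex tv.
  by move=> p q /leafE/sk -> /leafE/sk ->.
split; first by exists p0; [apply/leafE | apply: sk].
by move=> p /leafE/sk ->.
Qed.

(** * Enumeration of vertices and of trees of given size *)

Fixpoint vertices (t : motzkin) : seq (seq nat) :=
  match t with
  | Leaf => [:: [::]]
  | Unary u => [::] :: map (cons 0%N) (vertices u)
  | Binary l r =>
      [::] :: map (cons 0%N) (vertices l) ++ map (cons 1%N) (vertices r)
  end.

Lemma mem_map_cons (i j : nat) (v : seq nat) (s : seq (seq nat)) :
  (i :: v \in map (cons j) s) = (i == j) && (v \in s).
Proof.
apply/mapP/andP => [[w sw [-> ->]]|[/eqP -> sv]]; first by rewrite eqxx.
by exists v.
Qed.

Lemma nil_map_cons (j : nat) (s : seq (seq nat)) :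
  ([::] \in map (cons j) s) = false.
Proof. by apply/mapP => -[]. Qed.

Lemma mem_vertices (t : motzkin) (v : seq nat) :
  (v \in vertices t) = (subtree t v != None).
Proof.
elim: t v => [|u IHu|l IHl r IHr] [|i v] //=; first by case: i.
  rewrite inE /= mem_map_cons IHu; case: i => [|i] //=; by case: i.
rewrite inE /= mem_cat !mem_map_cons IHl IHr.
by case: i => [|[|i]] //=; rewrite ?orbF //; case: i.
Qed.

Lemma vertices_uniq (t : motzkin) : uniq (vertices t).
Proof.
have consI i : injective (cons i : seq nat -> seq nat) by move=> v w [].
elim: t => [|u IHu|l IHl r IHr] //=.
  by rewrite nil_map_cons map_inj_uniq.
rewrite mem_cat !nil_map_cons /= cat_uniq !map_inj_uniq // IHl IHr andbT /=.
by apply/hasPn => _ /mapP[v _ ->]; rewrite mem_map_cons.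
Qed.

Lemma mem_motzkin_trees (n : nat) (t : motzkin) :
  (t \in fset_set (motzkin_trees n)) = (nb_vertices t == n).
Proof.
rewrite in_fset_set; last exact: finite_motzkin_trees.
by apply/idP/eqP; rewrite inE.
Qed.

Lemma nb_vertices_gt0 (t : motzkin) : (0 < nb_vertices t)%N.
Proof. by case: t. Qed.

Lemma motzkin_trees0 : fset_set (motzkin_trees 0) = fset0.
Proof.
by apply/fsetP => t; rewrite mem_motzkin_trees inE gtn_eqF // nb_vertices_gt0.
Qed.

(** Case analysis on the root, a binary root being indexed by the size [i] of its left subtree. The
    extreme values of [i] contribute nothing, as no tree has size 0. *)
Lemma motzkin_treesS (n : nat) :
  perm_eq (fset_set (motzkin_trees n.+1))
    ((if n == 0%N then [:: Leaf] else [::])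
     ++ [seq Unary u | u <- fset_set (motzkin_trees n)]
     ++ [seq Binary p.1 p.2 | i <- iota 0 n.+1,
          p <- [seq (l, r) | l <- fset_set (motzkin_trees i),
                             r <- fset_set (motzkin_trees (n - i))]]).
Proof.
set s1 := (if _ then _ else _); set s2 := map _ _; set s3 := flatten _.
have m1 t : (t \in s1) = (n == 0%N) && (t == Leaf).
  by rewrite /s1; case: ifP; rewrite ?inE.
have m2 t : reflect (exists2 u, nb_vertices u = n & t = Unary u) (t \in s2).
  apply: (iffP mapP) => -[u un ->]; exists u => //.
    by move: un; rewrite mem_motzkin_trees => /eqP.
  by rewrite mem_motzkin_trees; apply/eqP.
have m3 t : reflect (exists l r, (nb_vertices l + nb_vertices r = n)%N
    /\ t = Binary l r) (t \in s3).
  apply: (iffP allpairsPdep).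
    move=> [i [p [iP /allpairsPdep[l [r [li ri ->]]] ->]]].
    exists l, r; split=> //.
    move: iP li ri; rewrite mem_iota !mem_motzkin_trees.
    by move=> /andP[_ i_n] /eqP -> /eqP ->; rewrite subnKC.
  move=> [l [r [lrn ->]]]; exists (nb_vertices l), (l, r); split=> //.
    by rewrite mem_iota /= ltnS -lrn leq_addr.
  apply/allpairsPdep; exists l, r; split=> //; rewrite mem_motzkin_trees //.
  by rewrite -lrn addKn.
apply: uniq_perm; first exact: fset_uniq.
  rewrite cat_uniq [uniq (s2 ++ s3)]cat_uniq.
  apply/and3P; split; first by rewrite /s1; case: ifP.
    apply/hasPn => t; rewrite mem_cat m1 => /orP[/m2[u _ ->]|/m3[l [r [_ ->]]]];
    by rewrite andbF.
  apply/and3P; split; first by rewrite map_inj_uniq ?fset_uniq // => u v [].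
    by apply/hasPn => t /m3[l [r [_ ->]]]; apply/m2 => -[].
  apply: (@allpairs_uniq_dep _ (fun=> (motzkin * motzkin)%type) _
    (fun _ p => Binary p.1 p.2)); first exact: iota_uniq.
    move=> i _; apply: allpairs_uniq; [exact: fset_uniq..|].
    by move=> [l r] [l' r'].
  (* Equal binary trees share their left subtree, whose size recovers the index. *)
  move=> _ _ /allpairsPdep[i [p [_ pP ->]]] /allpairsPdep[j [q [_ qP ->]]] /=.
  case/allpairsPdep: pP => l [r [li _ ->]].
  case/allpairsPdep: qP => l' [r' [lj _ ->]].
  move=> /= -[ll rr]; move: li lj; rewrite ll rr !mem_motzkin_trees.
  by move=> /eqP -> /eqP ->.
clearbody s1 s2 s3; move=> t; rewrite mem_motzkin_trees !mem_cat m1.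
case: t => [|u|l r] /=.
- rewrite eqSS eq_sym andbT; case: eqVneq => //= _.
  by apply/esym/negP => /orP[/m2[u _]|/m3[l [r [_]]]].
- rewrite andbF eqSS /=.
  apply/eqP/orP => [un|[/m2[v vn [->]]|/m3[l [r []]]]] //.
  by left; apply/m2; exists u.
rewrite andbF eqSS /=.
apply/eqP/orP => [lr|[/m2[]|/m3[l' [r' [? [-> ->]]]]]] //.
by right; apply/m3; exists l, r.
Qed.

Lemma sum_motzkin_treesS (f : motzkin -> nat) (n : nat) :
  (\sum_(t <- fset_set (motzkin_trees n.+1)) f t =
    (if n == 0 then f Leaf else 0)
    + \sum_(u <- fset_set (motzkin_trees n)) f (Unary u)
    + \sum_(i < n.+1) \sum_(l <- fset_set (motzkin_trees i))
        \sum_(r <- fset_set (motzkin_trees (n - i))) f (Binary l r))%N.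
Proof.
rewrite (perm_big _ (motzkin_treesS n)) 2!big_cat big_map.
rewrite [LHS]addnA.
congr (_ + _ + _); first by case: ifP; rewrite ?big_seq1 ?big_nil.
rewrite big_allpairs_dep -[iota 0 n.+1]/(index_iota 0 n.+1) big_mkord.
by apply: eq_bigr => i _; rewrite big_allpairs_dep.
Qed.

(** * Recurrences for the counts *)

Definition nb_perfect_vertices (k : nat) (t : motzkin) : nat :=
  count (perfect_at k t) (vertices t).

Lemma nb_perfect_vertices_Leaf (k : nat) :
  nb_perfect_vertices k Leaf = perfect k Leaf.
Proof. by rewrite /nb_perfect_vertices /= addn0. Qed.

Lemma nb_perfect_vertices_Unary (k : nat) (u : motzkin) :
  nb_perfect_vertices k (Unary u) =
    (perfect k (Unary u) + nb_perfect_vertices k u)%N.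
Proof. by rewrite /nb_perfect_vertices /= count_map. Qed.

Lemma nb_perfect_vertices_Binary (k : nat) (l r : motzkin) :
  nb_perfect_vertices k (Binary l r) =
    (perfect k (Binary l r) + nb_perfect_vertices k l
     + nb_perfect_vertices k r)%N.
Proof. by rewrite /nb_perfect_vertices /= count_cat !count_map addnA. Qed.

(** The pairs (tree, vertex) are grouped by tree. *)
Lemma balanced_numberE (k n : nat) :
  balanced_number k n =
    (\sum_(t <- fset_set (motzkin_trees n)) nb_perfect_vertices k t)%N.
Proof.
pose s := [seq (t, v) | t <- fset_set (motzkin_trees n),
                        v <- [seq v <- vertices t | perfect_at k t v]].
have s_uniq : uniq s.
  rewrite /s; apply: (@allpairs_uniq_dep _ (fun=> seq nat)
    (motzkin * seq nat)%type pair); first exact: fset_uniq.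
    by move=> t _; rewrite filter_uniq ?vertices_uniq.
  by move=> [t v] [t' v'] _ _ /= [-> ->].
have sE : perm_eq (fset_set (balanced_vertices k n)) s.
  apply: uniq_perm; [exact: fset_uniq | exact: s_uniq | move=> [t v]].
  rewrite in_fset_set; last exact: finite_balanced_vertices.
  apply/idP/allpairsPdep => [|[t' [v' [+ + [-> ->]]]]]; rewrite ?inE.
    move=> [/= tn tv bal rk]; exists t, v; split=> //.
      by rewrite mem_motzkin_trees; apply/eqP.
    rewrite mem_filter mem_vertices; apply/andP; split; last exact/eqP.
    exact/perfect_atP.
  rewrite mem_motzkin_trees mem_filter => /eqP t'n /andP[/perfect_atP[? ? ?] _].
  by split.
rewrite /balanced_number (perm_size sE) size_allpairs_dep sumnE big_map.
by apply: eq_bigr => t _; rewrite size_filter.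
Qed.

Lemma motzkin_number0 : motzkin_number 0 = 0%N.
Proof. by rewrite /motzkin_number motzkin_trees0. Qed.

Lemma motzkin_numberS (n : nat) :
  motzkin_number n.+1 =
    ((n == 0) + motzkin_number n
     + \sum_(i < n.+1) motzkin_number i * motzkin_number (n - i))%N.
Proof.
rewrite /motzkin_number -!sum1_size sum_motzkin_treesS; congr (_ + _ + _)%N.
apply: eq_bigr => i _; rewrite -!sum1_size big_distrlr.
by apply: eq_bigr => l _; apply: eq_bigr => r _.
Qed.

Definition perfect_number (k n : nat) : nat :=
  (\sum_(t <- fset_set (motzkin_trees n)) perfect k t)%N.

Lemma perfect_number0 (k : nat) : perfect_number k 0 = 0%N.
Proof. by rewrite /perfect_number motzkin_trees0 big_nil. Qed.

Lemma perfect_number_rank0 (n : nat) : perfect_number 0 n = (n == 1%N).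
Proof.
case: n => [|n]; first by rewrite perfect_number0.
rewrite /perfect_number sum_motzkin_treesS /= big1 // big1 => [|i _].
  by case: n.
by rewrite big1 // => l _; rewrite big1.
Qed.

Lemma perfect_numberS (k n : nat) :
  perfect_number k.+1 n.+1 =
    (perfect_number k n
     + \sum_(i < n.+1) perfect_number k i * perfect_number k (n - i))%N.
Proof.
rewrite /perfect_number sum_motzkin_treesS /= if_same add0n.
congr (_ + _)%N; apply: eq_bigr => i _.
rewrite big_distrlr /=; apply: eq_bigr => l _; apply: eq_bigr => r _.
by rewrite mulnb.
Qed.

Lemma balanced_number0 (k : nat) : balanced_number k 0 = 0%N.
Proof. by rewrite balanced_numberE motzkin_trees0 big_nil. Qed.

(** The marked vertex is the root, or lies below a unary root, or in one of two subtrees. The sum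
    [c] marks the right subtree; its reversal marks the left one, hence the factor 2. *)
Lemma balanced_numberS (k n : nat) :
  balanced_number k n.+1 =
    (perfect_number k n.+1 + balanced_number k n
     + 2 * \sum_(i < n.+1) motzkin_number i * balanced_number k (n - i))%N.
Proof.
set c := fun i : 'I_n.+1 => (motzkin_number i * balanced_number k (n - i))%N.
rewrite balanced_numberE /perfect_number !sum_motzkin_treesS /=.
rewrite nb_perfect_vertices_Leaf.
under eq_bigr do rewrite nb_perfect_vertices_Unary.
rewrite big_split /= -balanced_numberE.
set L := (if _ then _ else _); set U := bigop _ _ _.
set P := (\sum_(i < n.+1) \sum_(l <- _) \sum_(r <- _) (_ : bool))%N.
have -> : (\sum_(i < n.+1) \sum_(l <- fset_set (motzkin_trees i))
    \sum_(r <- fset_set (motzkin_trees (n - i)))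
      nb_perfect_vertices k (Binary l r)
    = P + (\sum_i c (rev_ord i) + \sum_i c i))%N.
  rewrite /P -!big_split /=; apply: eq_bigr => i _.
  rewrite /c /= subSS subKn -1?ltnS //.
  rewrite !balanced_numberE /motzkin_number -!sum1_size !big_distrlr /=.
  rewrite [X in (_ + (X + _))%N]exchange_big -!big_split /=.
  apply: eq_bigr => l _; rewrite -!big_split /=; apply: eq_bigr => r _.
  by rewrite nb_perfect_vertices_Binary mul1n mul1n addnA.
have -> : (\sum_i c (rev_ord i) = \sum_i c i)%N.
  by rewrite [RHS](reindex_inj rev_ord_inj).
rewrite -/(\sum_i c i)%N; lia.
Qed.

(** * Generating functions modulo a power of X *)

Lemma dvdXnP (F : fieldType) (n : nat) (p : {poly F}) :
  reflect (forall i, (i < n)%N -> p`_i = 0) ('X^n %| p).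
Proof.
apply: (iffP (dvdpP _ _)) => [[q ->] i i_n|p0]; first by rewrite coefMXn i_n.
exists (drop_poly n p); rewrite -[LHS](poly_take_drop n) -[RHS]add0r.
congr (_ + _); apply/polyP => i; rewrite coef_take_poly coef0.
by case: ifP => // /p0.
Qed.

Lemma coef_Xderiv (R : nzRingType) (p : {poly R}) (n : nat) :
  ('X * p^`())`_n = p`_n *+ n.
Proof. by case: n => [|n]; rewrite coefXM ?mulr0n // coef_deriv. Qed.

(** Differentiation alone could lose one order of vanishing; the factor X restores it. *)
Lemma dvdXn_Xderiv (F : fieldType) (n : nat) (p : {poly F}) :
  'X^n %| p -> 'X^n %| 'X * p^`().
Proof.
move=> /dvdXnP p0; apply/dvdXnP => i i_n.
by rewrite coef_Xderiv p0 // mul0rn.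
Qed.

(* Identities between power series become divisibilities by 'X^N between
   truncations. *)
Definition truncgf (F : fieldType) (N : nat) (u : nat -> nat) : {poly F} :=
  \poly_(i < N) (u i)%:R.

Lemma coef_truncgf (F : fieldType) (N : nat) (u : nat -> nat) (i : nat) :
  (i < N)%N -> (truncgf F N u)`_i = (u i)%:R.
Proof. by move=> i_N; rewrite coef_poly i_N. Qed.

Lemma coef_truncgfM (F : fieldType) (N : nat) (u v : nat -> nat) (i : nat) :
  (i < N)%N -> (truncgf F N u * truncgf F N v)`_i =
    (\sum_(j < i.+1) u j * v (i - j))%N%:R.
Proof.
move=> i_N; rewrite coefM natr_sum; apply: eq_bigr => j _.
by rewrite !coef_truncgf ?natrM //; have := ltn_ord j; lia.
Qed.

Fixpoint perfectgf (F : fieldType) (k : nat) : {poly F} :=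
  if k is k'.+1 then 'X * (perfectgf F k' + perfectgf F k' ^+ 2) else 'X.

Lemma coef_perfectgf (F : fieldType) (k n : nat) :
  (perfectgf F k)`_n = (perfect_number k n)%:R.
Proof.
elim: k n => [|k IHk] n /=; first by rewrite coefX perfect_number_rank0.
rewrite coefXM; case: n => [|n] /=; first by rewrite perfect_number0.
rewrite perfect_numberS natrD coefD IHk expr2 coefM; congr (_ + _).
by rewrite natr_sum; apply: eq_bigr => i _; rewrite !IHk natrM.
Qed.

Lemma motzkin_gf (F : fieldType) (N : nat) (M := truncgf F N motzkin_number) :
  'X^N %| M - 'X * (1 + M + M ^+ 2).
Proof.
apply/dvdXnP => -[|n] n_N; rewrite coefB coefXM coef_truncgf //=.
  by rewrite motzkin_number0 subrr.
rewrite motzkin_numberS !natrD 2!coefD coef1 coef_truncgf 1?ltnW //.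
by rewrite expr2 coef_truncgfM 1?ltnW // subrr.
Qed.

Lemma balanced_gf (F : fieldType) (N k : nat) (M := truncgf F N motzkin_number)
    (B := truncgf F N (balanced_number k)) :
  'X^N %| (1 - 'X - 2%:R * 'X * M) * B - perfectgf F k.
Proof.
have -> : (1 - 'X - 2%:R * 'X * M) * B - perfectgf F k =
    B - perfectgf F k - 'X * (B + (M * B) *+ 2) by ring.
apply/dvdXnP => -[|n] n_N;
  rewrite 2!coefB coefXM coef_truncgf // coef_perfectgf /=.
  by rewrite balanced_number0 perfect_number0 !subr0.
rewrite coefD coefMn coef_truncgf 1?ltnW // coef_truncgfM 1?ltnW //.
by rewrite balanced_numberS natrD natrM natrD; ring.
Qed.

(** The factor D has constant term 1, so it is coprime to X; this replaces its invertibility as a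
    power series. *)
Lemma dvdXn_cancel (F : fieldType) (N : nat) (M p : {poly F}) :
  'X^N %| (1 - 'X - 2%:R * 'X * M) * p -> 'X^N %| p.
Proof.
have := coprimep_XsubC (1 - 'X - 2%:R * 'X * M) 0.
rewrite subr0 coprimep_sym /root !hornerE !subr0 oner_eq0 => cXD.
by rewrite Gauss_dvdpr // coprimep_expl.
Qed.

(** * Expressing the counts through marked leaves *)

Lemma balanced_number_leaves (k n : nat) (F : fieldType) :
  (balanced_number k n)%:R = \sum_(j < n.+2)
    (perfect_number k j)%:R * (balanced_number 0 (n.+1 - j))%:R :> F.
Proof.
pose M := truncgf F n.+2 motzkin_number.
pose D : {poly F} := 1 - 'X - 2%:R * 'X * M.
pose B := truncgf F n.+2 (balanced_number k).
pose L := truncgf F n.+2 (balanced_number 0).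
pose A := perfectgf F k.
have DB : 'X^(n.+2) %| D * B - A := balanced_gf F n.+2 k.
have DL : 'X^(n.+2) %| D * L - 'X := balanced_gf F n.+2 0.
have /dvdXn_cancel/dvdXnP/(_ n.+1 (ltnSn _)) :
    (* Truncating at order n + 2 keeps the coefficient of X^(n+1), which is compared once D is
       cancelled. *)
    'X^(n.+2) %| D * ('X * B - A * L).
  have -> : D * ('X * B - A * L) = 'X * (D * B - A) - A * (D * L - 'X) by ring.
  by rewrite dvdp_sub // dvdp_mull.
rewrite coefB coefXM coef_truncgf //= => /subr0_eq ->; rewrite coefM.
apply: eq_bigr => j _; rewrite coef_perfectgf coef_truncgf //.
by rewrite ltnS leq_subr.
Qed.

(* n m_n is the coefficient of the Euler derivative V = X M', and D V = M. *)
Lemma total_vertices_leaves (n : nat) (F : fieldType) :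
  2 * (n%:R * (motzkin_number n)%:R) =
    (balanced_number 0 n.+2)%:R - (balanced_number 0 n.+1)%:R :> F.
Proof.
pose M := truncgf F n.+3 motzkin_number.
pose D : {poly F} := 1 - 'X - 2%:R * 'X * M.
pose L := truncgf F n.+3 (balanced_number 0); pose V := 'X * M^`().
pose E := M - 'X * (1 + M + M ^+ 2).
have E0 : 'X^(n.+3) %| E := motzkin_gf F n.+3.
have DL : 'X^(n.+3) %| D * L - 'X := balanced_gf F n.+3 0.
have DV : 'X^(n.+3) %| D * V - M.
  (* Euler derivative of the functional equation [E] of M. *)
  have -> : D * V - M = 'X * E^`() - E.
    rewrite /E /D /V expr2 !(derivD, derivN, derivM, derivX, derivC, derivE).
    by ring.
  by rewrite dvdp_sub // dvdXn_Xderiv.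
have XV : 'X^(n.+3) %| 'X * V - M * L.
  apply: (@dvdXn_cancel _ _ M); rewrite -/D.
  have -> : D * ('X * V - M * L) = 'X * (D * V - M) - M * (D * L - 'X) by ring.
  by rewrite dvdp_sub // dvdp_mull.
(* Since X V = M L and 2 X M L = L - X L - X modulo the truncation, M L is eliminated. *)
have /dvdXnP/(_ n.+2 (ltnSn _)) : 'X^(n.+3) %|
    'X * ('X * ('X * M^`())) *+ 2 - (L - 'X * L - 'X).
  have -> : 'X * ('X * ('X * M^`())) *+ 2 - (L - 'X * L - 'X) =
      2%:R * 'X * ('X * V - M * L) - (D * L - 'X) by rewrite /D /V; ring.
  by rewrite dvdp_sub // dvdp_mull.
rewrite !(coef_Xderiv, coefB, coefMn, coefXM) /= coefX /= !coef_truncgf //.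
  by rewrite subr0 => /subr0_eq <-; rewrite !mulr_natl.
by lia.
Qed.

(* The Euler operator X d/dX applied to D L = X and to D^2 = 1 - 2 X - 3 X^2;
   eliminating the derivative of D leaves a differential equation for L. *)
Lemma leaves_rec (n : nat) :
  (n.+1 * balanced_number 0 n.+2 =
    n.*2.+1 * balanced_number 0 n.+1 + 3 * n * balanced_number 0 n)%N.
Proof.
(* Characteristic 0 allows division by 2 and the return to natural numbers. *)
pose F : fieldType := rat; apply/eqP; rewrite -(eqr_nat rat); apply/eqP.
pose M := truncgf F n.+3 motzkin_number.
pose D : {poly F} := 1 - 'X - 2%:R * 'X * M.
pose L := truncgf F n.+3 (balanced_number 0).
pose E := M - 'X * (1 + M + M ^+ 2).
pose Delta : {poly F} := 1 - 2%:R * 'X - 3%:R * 'X ^+ 2.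
have E0 : 'X^(n.+3) %| E := motzkin_gf F n.+3.
pose e2 := D * L - 'X; pose e3 := D ^+ 2 - Delta.
have e2_0 : 'X^(n.+3) %| e2 := balanced_gf F n.+3 0.
(* [Delta] is the discriminant of the quadratic equation satisfied by M. *)
have e3_0 : 'X^(n.+3) %| e3.
  have -> : e3 = - (4%:R * 'X * E) by rewrite /e3 /Delta /D /E; ring.
  by rewrite dvdpNr dvdp_mull.
(* [T] is Delta X L' - (1 - X) L, written so that its coefficients can be read off; it vanishes
   modulo the truncation. *)
pose T := 'X * L^`() - 'X * ('X * L^`()) *+ 2 - 'X * ('X * ('X * L^`())) *+ 3
  - L + 'X * L.
have : 'X^(n.+3) %| 2%:R * T.
  have -> : 2%:R * T = 2%:R * D * ('X * e2^`()) - L * ('X * e3^`())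
      - 2%:R * ('X * L^`()) * e3 - (- 2%:R * L) * e3 - (2%:R * D) * e2.
    rewrite /T /e2 /e3 /Delta !expr2.
    rewrite !(derivD, derivN, derivM, derivX, derivC, derivE).
    by ring.
  by rewrite !dvdp_sub // dvdp_mull // dvdXn_Xderiv.
rewrite mulr_natl -scaler_nat.
rewrite dvdpZr ?pnatr_eq0 // => /dvdXnP/(_ n.+2 (ltnSn _)).
rewrite /T !(coefB, coefD, coefMn, coef_Xderiv, coefXM) /=.
rewrite !coef_truncgf //; try lia.
move: (balanced_number 0 n.+2) (balanced_number 0 n.+1) (balanced_number 0 n).
move=> a b c rec; apply/subr0_eq; rewrite -[RHS]rec -mul2n; ring.
Qed.

(** * Growth of the number of marked leaves *)

Lemma leaves1 : balanced_number 0 1 = 1%N.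
Proof.
rewrite balanced_numberS balanced_number0 perfect_number_rank0 big_ord1.
by rewrite motzkin_number0.
Qed.

(* In terms of l n = balanced_number 0 n, this is
   3 - 2 / n.+1 <= l n.+2 / l n.+1 <= 3, in a form stable under leaves_rec. *)
Lemma leaves_growth (n : nat) :
  [/\ (0 < balanced_number 0 n.+1)%N,
   (n.+1 * balanced_number 0 n.+2 <= 3 * n.+1 * balanced_number 0 n.+1)%N &
   ((3 * n).+1 * balanced_number 0 n.+1 <= n.+1 * balanced_number 0 n.+2)%N].
Proof.
elim: n => [|n [l_gt0 ub lb]].
  by have := leaves_rec 0; rewrite leaves1 muln0 mul0n addn0 !mul1n => ->.
(* Through the recurrence, the lower bound at [n] gives the next upper bound, and the upper bound
   gives the next lower bound. *)
have rec := leaves_rec n.+1.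
have l1_gt0 : (0 < balanced_number 0 n.+2)%N by nia.
by split=> //; nia.
Qed.

Lemma leaves_gt0 (n : nat) : (0 < balanced_number 0 n.+1)%N.
Proof. by have [] := leaves_growth n. Qed.

Lemma cvg_leaves_quotient (R : realType) :
  ((balanced_number 0 n.+2)%:R / (balanced_number 0 n.+1)%:R : R)
    @[n --> \oo] --> (3 : R).
Proof.
(* Since [harmonic n] is 1 / (n + 1), this is the lower bound of [leaves_growth]. *)
have lo : (3 - 2 * @harmonic R n) @[n --> \oo] --> (3 : R).
  rewrite -[X in _ --> X]subr0 -(mulr0 2).
  apply: cvgB; first exact: cvg_cst.
  by apply: cvgM; [exact: cvg_cst | exact: cvg_harmonic].
apply: squeeze_cvgr lo (cvg_cst _); apply: nearW => n /=.
have [l_gt0 ub lb] := leaves_growth n.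
have l0 : 0 < (balanced_number 0 n.+1)%:R :> R by rewrite ltr0n.
rewrite ler_pdivlMr // ler_pdivrMr //; apply/andP; split; last first.
  rewrite -natrM ler_nat; move: ub.
  rewrite -mulnA [(3 * _)%N]mulnC -mulnA leq_mul2l /=.
  by rewrite mulnC.
rewrite -(ler_pM2l (ltr0Sn R n)) mulrA mulrBr mulrCA mulfV ?pnatr_eq0 //.
have -> : n.+1%:R * 3 - 2 * 1 = (3 * n).+1%:R :> R.
  by rewrite -!natr1 natrM; ring.
by rewrite -!natrM ler_nat.
Qed.

(** A shift by [j] multiplies [j] inverse consecutive quotients, each tending to 1/3. *)
Lemma cvg_leaves_shift (R : realType) (j : nat) :
  ((balanced_number 0 (n.+1 - j))%:R / (balanced_number 0 n.+1)%:R : R)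
    @[n --> \oo] --> (3^-1 ^+ j : R).
Proof.
elim: j => [|j IHj].
  rewrite expr0; apply: cvg_near_cst; apply: nearW => n.
  by rewrite subn0 divff // pnatr_eq0 -lt0n leaves_gt0.
rewrite -cvg_shiftS exprSr.
have three_neq0 : 3 != 0 :> R by rewrite pnatr_eq0.
apply: cvg_trans; last first.
  exact: (cvgM IHj (cvgV three_neq0 (cvg_leaves_quotient R))).
apply: near_eq_cvg; apply: nearW => n /=.
have l0 m : (balanced_number 0 m.+1)%:R != 0 :> R.
  by rewrite pnatr_eq0 -lt0n leaves_gt0.
by rewrite subSS invf_div mulrA divfK.
Qed.

(** * Limits of the proportions *)

Lemma cvg_balanced_ratio (R : realType) (k : nat) :
  balanced_ratio R k n @[n --> \oo] --> (perfectgf R k).[3^-1].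
Proof.
set A := perfectgf R k.
pose l n : R := (balanced_number 0 n)%:R.
have l0 m : l m.+1 != 0 by rewrite pnatr_eq0 -lt0n leaves_gt0.
(* The sum stops at [size A], a length free of [n], so the limit can be taken termwise. *)
pose S n := \sum_(j < size A) A`_j * (l (n.+1 - j)%N / l n.+1).
have S_cvg : S n @[n --> \oo] --> A.[3^-1].
  rewrite horner_coef /S; apply: cvg_big; first exact: add_continuous.
  move=> j _; apply: cvgM; first exact: cvg_cst.
  exact: cvg_leaves_shift.
(* This factor is [l n.+1] divided by n m_n. *)
have T_cvg : (2 / (l n.+2 / l n.+1 - 1)) @[n --> \oo] --> (1 : R).
  have e2 : 3 - 1 = 2 :> R by ring.
  rewrite -[X in _ --> X](@divff _ (3 - 1)) e2 ?pnatr_eq0 // -[X in _ / X]e2.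
  apply: cvgM; first exact: cvg_cst.
  apply: cvgV; first by rewrite e2 pnatr_eq0.
  by apply: cvgB; [exact: cvg_leaves_quotient | exact: cvg_cst].
rewrite -[A.[_]]mulr1; apply: cvg_trans; last exact: (cvgM S_cvg T_cvg).
apply: near_eq_cvg; near=> n.
(* For large [n] the convolution covers all nonzero coefficients of [A]. *)
have size_n : (size A <= n.+2)%N.
  by apply: leq_trans (_ : n <= _)%N; [near: n; exact: nbhs_infty_ge | lia].
have bE : (balanced_number k n)%:R = S n * l n.+1.
  rewrite balanced_number_leaves -(big_mkord xpredT
    (fun j => (perfect_number k j)%:R * (balanced_number 0 (n.+1 - j))%:R)).
  rewrite (big_cat_nat (n := size A)) //= [X in _ + X]big1_seq ?addr0.
    rewrite big_mkord /S mulr_suml; apply: eq_bigr => j _.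
    by rewrite -mulrA divfK // -coef_perfectgf.
  move=> j /andP[_]; rewrite mem_index_iota => /andP[Aj _].
  by rewrite -coef_perfectgf nth_default ?mul0r.
rewrite /balanced_ratio bE -mulrA; congr (_ * _).
have /(canRL (mulKf _)) -> := total_vertices_leaves n R; last first.
  by rewrite pnatr_eq0.
have -> : l n.+2 / l n.+1 - 1 = (l n.+2 - l n.+1) / l n.+1.
  by rewrite mulrBl divff.
by rewrite invf_div invfM invrK mulrCA.
Unshelve. all: by end_near.
Qed.

Theorem theorem4p3 (R : realType) :
  (forall k : nat, cvg (balanced_ratio R k n @[n --> \oo])) /\
  (forall k : nat, (1 <= k)%N ->
     balanced_proportion R k =
       1 / 3 * balanced_proportion R k.-1
         + 1 / 3 * balanced_proportion R k.-1 ^+ 2).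
Proof.
have limE k : balanced_proportion R k = (perfectgf R k).[3^-1].
  by apply/cvg_lim; [exact: Rhausdorff | exact: cvg_balanced_ratio].
rewrite div1r; split=> [k|[//|k] _].
  by apply/cvg_ex; eexists; exact: cvg_balanced_ratio.
(* Evaluating the recursion for [perfectgf] at 1/3 gives the claim. *)
by rewrite !limE /= hornerM hornerX hornerD horner_exp mulrDr.
Qed.
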